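(* Let $\mathbf{S}=(S_{\boldsymbol{\alpha}})_{\boldsymbol{\alpha}}$ be an optimal solution of the $r$-th order correlative sparsity adapted moment relaxation (with optimal value $\lambda_r^{(\mathrm{cs})}$), $r\ge r_{\min}$, of the polynomial matrix optimization problem with optimal value $\lambda^\star$. Assume: (i) there exist weight matrices $W_1,\ldots,W_s\in\mathbb{S}^p_+$ such that for each $\ell\in[t]$ the sequence $\mathbf{S}^\ell:=(S_{\boldsymbol{\alpha}})_{\mathrm{supp}(\boldsymbol{\alpha})\subseteq\mathcal{I}_\ell}$ admits a representing matrix measure $\Phi_\ell=\sum_{i=1}^sW_i\,\delta_{\boldsymbol{x}^i(\ell)}$ for some points $\boldsymbol{x}^1(\ell),\ldots,\boldsymbol{x}^s(\ell)\in\mathbf{K}_\ell$; (ii) for each $i\in[s]$, the points $\boldsymbol{x}^i(1),\ldots,\boldsymbol{x}^i(t)$ can be merged into a single point $\hat{\boldsymbol{x}}^i\in\mathbb{R}^n$ such that $\hat{\boldsymbol{x}}^i(\ell):=(\hat x^i_j)_{j\in\mathcal{I}_\ell}=\boldsymbol{x}^i(\ell)$ for every $\ell\in[t]$. Then $\lambda_r^{(\mathrm{cs})}=\lambda^\star$. Moreover, each point $\hat{\boldsymbol{x}}^i$, $i\in[s]$, is an optimal solution of the polynomial matrix optimization problem.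
   Context: **Problem.** $\lambda^\star:=\inf_{\boldsymbol{x}\in\mathbb{R}^n}\lambda_{\min}(F(\boldsymbol{x}))$ s.t. $G_1(\boldsymbol{x})\succeq0,\ldots,G_m(\boldsymbol{x})\succeq0$, where $F$ is a symmetric $p\times p$ real polynomial matrix, $G_k$ a symmetric $q_k\times q_k$ real polynomial matrix, and $\lambda_{\min}$ is the smallest eigenvalue. An optimal solution is a feasible point $\boldsymbol{x}$ with $\lambda_{\min}(F(\boldsymbol{x}))=\lambda^\star$. Set $d_k=\lceil\deg G_k/2\rceil$ (degree = maximum degree of entries), $r_{\min}=\max\{\lceil\deg F/2\rceil,d_1,\ldots,d_m\}$, $[t]=\{1,\ldots,t\}$, $|\boldsymbol{\alpha}|=\sum_i\alpha_i$, $\mathbb{N}^n_d=\{\boldsymbol{\alpha}\in\mathbb{N}^n:|\boldsymbol{\alpha}|\le d\}$. For a multi-index, $\mathrm{supp}(\boldsymbol{\alpha})=\{k:\alpha_k\ne0\}$. $\mathbb{S}^p_+$ is the set of real symmetric positive semidefinite (PSD) $p\times p$ matrices. Write $F=\sum_{\boldsymbol{\alpha}}F_{\boldsymbol{\alpha}}\boldsymbol{x}^{\boldsymbol{\alpha}}$, $G_k=\sum_{\boldsymbol{\gamma}}(G_k)_{\boldsymbol{\gamma}}\boldsymbol{x}^{\boldsymbol{\gamma}}$ with matrix coefficients. **Correlative sparsity.** The correlative sparsity pattern graph has vertex set $[n]$; $i,j$ are adjacent if $i,j\in\mathrm{supp}(\boldsymbol{\alpha})$ for some $\boldsymbol{\alpha}$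 with $F_{\boldsymbol{\alpha}}\neq0$, or if $x_i,x_j$ both effectively occur in some $G_k$. $\mathcal{I}_1,\ldots,\mathcal{I}_t$ are its maximal cliques. $\mathcal{J}_1,\ldots,\mathcal{J}_t$ are pairwise disjoint subsets of $[m]$ with union $[m]$ such that for $k\in\mathcal{J}_\ell$ all variables of $G_k$ have index in $\mathcal{I}_\ell$. $\mathbf{K}_\ell=\{\boldsymbol{x}(\ell)=(x_i)_{i\in\mathcal{I}_\ell}\in\mathbb{R}^{|\mathcal{I}_\ell|}: G_k(\boldsymbol{x})\succeq0\ \forall k\in\mathcal{J}_\ell\}$. **Relaxation.** For $\mathbf{S}=(S_{\boldsymbol{\alpha}})_{\boldsymbol{\alpha}\in\mathbb{N}^n_{2r}}$ with $S_{\boldsymbol{\alpha}}$ real symmetric $p\times p$, $\mathscr{L}_{\mathbf{S}}(F)=\sum_{\boldsymbol{\alpha}}\mathrm{tr}(F_{\boldsymbol{\alpha}}S_{\boldsymbol{\alpha}})$. For $\mathcal{I}\subseteq[n]$, $M_d(\mathbf{S},\mathcal{I})$ is the block matrix with blocks indexed by $\boldsymbol{\alpha},\boldsymbol{\beta}\in\mathbb{N}^n_d$ with supports in $\mathcal{I}$, whose $(\boldsymbol{\alpha},\boldsymbol{\beta})$ block is $S_{\boldsymbol{\alpha}+\boldsymbol{\beta}}$; $M_d(G\mathbf{S},\mathcal{I})$ is the analogous block matrix with blocks $\sum_{\boldsymbol{\gamma}}S_{\boldsymbol{\alpha}+\boldsymbol{\beta}+\boldsymbol{\gamma}}\otimes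 G_{\boldsymbol{\gamma}}$. The $r$-th order relaxation is $$\lambda_r^{(\mathrm{cs})}:=\inf_{\mathbf{S}}\ \mathscr{L}_{\mathbf{S}}(F)\ \text{ s.t. } M_r(\mathbf{S},\mathcal{I}_\ell)\succeq0\ (\ell\in[t]),\ M_{r-d_k}(G_k\mathbf{S},\mathcal{I}_\ell)\succeq0\ (k\in\mathcal{J}_\ell,\ \ell\in[t]),\ \mathscr{L}_{\mathbf{S}}(I_p)=1.$$ **Measures.** $\delta_{\boldsymbol{x}}$ is the Dirac measure at $\boldsymbol{x}$. A finitely atomic PSD matrix-valued measure $\Phi=\sum_iW_i\delta_{\boldsymbol{x}^i}$ with $W_i\in\mathbb{S}^p_+$ and $\boldsymbol{x}^i\in\mathbf{K}_\ell$ is a representing measure of $\mathbf{S}^\ell=(S_{\boldsymbol{\alpha}})_{|\boldsymbol{\alpha}|\le2r,\ \mathrm{supp}(\boldsymbol{\alpha})\subseteq\mathcal{I}_\ell}$ if $S_{\boldsymbol{\alpha}}=\int\boldsymbol{x}^{\boldsymbol{\alpha}}\,\mathrm{d}\Phi=\sum_iW_i(\boldsymbol{x}^i)^{\boldsymbol{\alpha}}$ for all such $\boldsymbol{\alpha}$.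
   Formalization: The ''moreover'' clause asserts optimality of each merged point only for indices i with nonzero weight matrix W_i; if W_i = 0 is allowed, that point is an arbitrary feasible point and need not be optimal. *)

(* Defs.v *)
(* The notations of [mpoly] clash with those of MathComp-Analysis, hence the
   filtered import: {mpoly R[n]} is written [mpoly n R], 'X_{1..n} is
   [multinom n], and 'X_{1..n < d} is [bmultinom n d]. *)
From mathcomp Require Import all_boot all_order all_algebra.
From mathcomp Require Import boolp classical_sets reals ereal.
From mathcomp Require Import mxtens.
From mathcomp Require Import -(notations) mpoly.

Set Implicit Arguments.
Unset Strict Implicit.
Unset Printing Implicit Defensive.

Import Order.TTheory GRing.Theory Num.Theory.
Local Open Scope ring_scope.

Definition psd (R : realType) (N : nat) (A : 'M[R]_N) : Prop :=
  A^T = A /\ forall v : 'rV[R]_N, 0 <= (v *m A *m v^T) 0 0.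

(* For symmetric [A] of positive size the set of eigenvalues is finite and
   nonempty, so this infimum is the smallest eigenvalue. *)
Definition lambda_min (R : realType) (p : nat) (A : 'M[R]_p) : R :=
  inf [set a : R | eigenvalue A a]%classic.

Definition msupport (n : nat) (a : multinom n) : {set 'I_n} :=
  [set k | a k != 0%N]%SET.

Definition coefmx (R : realType) (n p : nat) (a : multinom n)
    (F : 'M[mpoly n R]_p) : 'M[R]_p :=
  map_mx (mcoeff a) F.

Definition evalmx (R : realType) (n p : nat) (x : 'I_n -> R)
    (F : 'M[mpoly n R]_p) : 'M[R]_p :=
  map_mx (meval x) F.

(* [mmeasure mdeg] is [msize], i.e. one plus the total degree, or 0 at the zero
   polynomial; hence the zero matrix has degree 0 here. *)
Definition mxdeg (R : realType) (n p : nat) (F : 'M[mpoly n R]_p) : nat :=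
  \max_(i < p) \max_(j < p) (mmeasure mdeg (F i j)).-1.

Definition half_deg (R : realType) (n p : nat) (F : 'M[mpoly n R]_p) : nat :=
  uphalf (mxdeg F).

Definition occurs (R : realType) (n p : nat) (F : 'M[mpoly n R]_p)
    (i : 'I_n) : Prop :=
  exists2 a : multinom n, coefmx a F != 0 & i \in msupport a.

Definition feasible (R : realType) (n m : nat) (q : 'I_m -> nat)
    (G : forall k : 'I_m, 'M[mpoly n R]_(q k)) (x : 'I_n -> R) : Prop :=
  forall k : 'I_m, psd (evalmx x (G k)).

Definition lambda_star (R : realType) (n p m : nat) (q : 'I_m -> nat)
    (F : 'M[mpoly n R]_p) (G : forall k : 'I_m, 'M[mpoly n R]_(q k)) : \bar R :=
  ereal_inf [set (lambda_min (evalmx x F))%:E | x in feasible G]%classic.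

Definition pmo_optimal (R : realType) (n p m : nat) (q : 'I_m -> nat)
    (F : 'M[mpoly n R]_p) (G : forall k : 'I_m, 'M[mpoly n R]_(q k))
    (x : 'I_n -> R) : Prop :=
  feasible G x /\ (lambda_min (evalmx x F))%:E = lambda_star F G.

Definition r_min (R : realType) (n p m : nat) (q : 'I_m -> nat)
    (F : 'M[mpoly n R]_p) (G : forall k : 'I_m, 'M[mpoly n R]_(q k)) : nat :=
  maxn (half_deg F) (\max_(k < m) half_deg (G k)).

Definition csp_graph (R : realType) (n p m : nat) (q : 'I_m -> nat)
    (F : 'M[mpoly n R]_p) (G : forall k : 'I_m, 'M[mpoly n R]_(q k)) :
    rel 'I_n :=
  fun i j => (i != j) &&
    `[< (exists a : multinom n,
           [/\ coefmx a F != 0, i \in msupport a & j \in msupport a]) \/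
        (exists k : 'I_m, occurs (G k) i /\ occurs (G k) j) >].

Definition clique (T : finType) (e : rel T) (C : {set T}) : bool :=
  [forall i in C, forall j in C, (i != j) ==> e i j].

Definition enumerates_maximal_cliques (T : finType) (e : rel T) (t : nat)
    (I : 'I_t -> {set T}) : Prop :=
  injective I /\
  forall C : {set T}, maxset (clique e) C <-> exists l : 'I_t, I l = C.

Definition csp_assignment (R : realType) (n m : nat) (q : 'I_m -> nat)
    (G : forall k : 'I_m, 'M[mpoly n R]_(q k)) (t : nat)
    (I : 'I_t -> {set 'I_n}) (J : 'I_t -> {set 'I_m}) : Prop :=
  [/\ forall l1 l2 : 'I_t, l1 != l2 -> [disjoint J l1 & J l2],
      (\bigcup_(l < t) J l)%SET = [set: 'I_m]%SET &
      forall (l : 'I_t) (k : 'I_m), k \in J l ->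
        forall i : 'I_n, occurs (G k) i -> i \in I l].

(* Points of R^C, C a set of variables.  Polynomials only involving variables
   in C are evaluated at such a point through its extension by zero. *)
Definition subpoint (R : realType) (n : nat) (C : {set 'I_n}) : Type :=
  {j : 'I_n | j \in C} -> R.

Definition extend0 (R : realType) (n : nat) (C : {set 'I_n})
    (y : subpoint R C) : 'I_n -> R :=
  fun j => if insub j is Some u then y u else 0.

Definition Kset (R : realType) (n m : nat) (q : 'I_m -> nat)
    (G : forall k : 'I_m, 'M[mpoly n R]_(q k)) (C : {set 'I_n})
    (D : {set 'I_m}) : set (subpoint R C) :=
  [set y | forall k : 'I_m, k \in D -> psd (evalmx (extend0 y) (G k))]%classic.

(* [momseq R n p d] is the type of families of p x p matrices indexed by the
   multi-indices of degree at most d. *)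
Definition momseq (R : realType) (n p d : nat) : Type :=
  bmultinom n d.+1 -> 'M[R]_p.

(* S_a for an arbitrary multi-index; the value 0 beyond degree d is junk. *)
Definition mom (R : realType) (n p d : nat) (S : momseq R n p d)
    (a : multinom n) : 'M[R]_p :=
  if insub a is Some b then S b else 0.

Definition riesz (R : realType) (n p d : nat) (S : momseq R n p d)
    (F : 'M[mpoly n R]_p) : R :=
  \sum_(a : bmultinom n d.+1) \tr (coefmx a F *m S a).

Definition mbasis (n : nat) (C : {set 'I_n}) (d : nat) :
    {set bmultinom n d.+1} :=
  [set a : bmultinom n d.+1 | msupport a \subset C]%SET.

Definition moment_mx (R : realType) (n p d : nat) (S : momseq R n p d)
    (e : nat) (C : {set 'I_n}) :=
  \mxblock_(i < #|mbasis C e|, j < #|mbasis C e|)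
     mom S (mnm_add (enum_val i) (enum_val j)).

Definition localizing_mx (R : realType) (n p q d : nat) (S : momseq R n p d)
    (G : 'M[mpoly n R]_q) (e : nat) (C : {set 'I_n}) :=
  \mxblock_(i < #|mbasis C e|, j < #|mbasis C e|)
     \sum_(c : bmultinom n (mxdeg G).+1)
        tensmx (mom S (mnm_add (mnm_add (enum_val i) (enum_val j)) c))
               (coefmx c G).

Definition cs_feasible (R : realType) (n p m : nat) (q : 'I_m -> nat)
    (G : forall k : 'I_m, 'M[mpoly n R]_(q k)) (t : nat)
    (I : 'I_t -> {set 'I_n}) (J : 'I_t -> {set 'I_m}) (r : nat)
    (S : momseq R n p (2 * r)) : Prop :=
  [/\ forall a, (S a)^T = S a,
      forall l : 'I_t, psd (moment_mx S r (I l)),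
      forall (l : 'I_t) (k : 'I_m), k \in J l ->
        psd (localizing_mx S (G k) (r - half_deg (G k)) (I l)) &
      riesz S 1%:M = 1].

Definition lambda_cs (R : realType) (n p m : nat) (q : 'I_m -> nat)
    (F : 'M[mpoly n R]_p) (G : forall k : 'I_m, 'M[mpoly n R]_(q k)) (t : nat)
    (I : 'I_t -> {set 'I_n}) (J : 'I_t -> {set 'I_m}) (r : nat) : \bar R :=
  ereal_inf [set (riesz S F)%:E
            | S in @cs_feasible R n p m q G t I J r]%classic.

Definition cs_optimal (R : realType) (n p m : nat) (q : 'I_m -> nat)
    (F : 'M[mpoly n R]_p) (G : forall k : 'I_m, 'M[mpoly n R]_(q k)) (t : nat)
    (I : 'I_t -> {set 'I_n}) (J : 'I_t -> {set 'I_m}) (r : nat)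
    (S : momseq R n p (2 * r)) : Prop :=
  cs_feasible G I J S /\ (riesz S F)%:E = lambda_cs F G I J r.

(* The integral of [f] against the finitely atomic matrix measure
   \sum_i W_i \delta_(y_i). *)
Definition atomic_integral (R : realType) (p s : nat) (T : Type)
    (W : 'I_s -> 'M[R]_p) (y : 'I_s -> T) (f : T -> R) : 'M[R]_p :=
  \sum_(i < s) f (y i) *: W i.

(* [mmap1 x a] is the monomial \prod_i x_i ^+ a_i. *)
Definition represents (R : realType) (n p d s : nat) (C : {set 'I_n})
    (S : momseq R n p d) (W : 'I_s -> 'M[R]_p)
    (y : 'I_s -> subpoint R C) : Prop :=
  forall a : bmultinom n d.+1, msupport a \subset C ->
    S a = atomic_integral W y (fun z => mmap1 (extend0 z) a).

(* Main.v *)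
(* Every monomial of F has its support in a clique, so condition (i) evaluates
   L_S(F) to \sum_i tr(F(xhat_i) W_i), where \sum_i tr(W_i) = 1 and each xhat_i
   is feasible.  As tr(A W) >= lambda_min(A) tr(W) for W PSD, this average
   dominates \sum_i lambda_min(F(xhat_i)) tr(W_i) >= lambda_star.  Conversely, a
   feasible point x with a unit eigenvector v of F(x) for lambda_min(F(x)) gives
   the feasible moment sequence x^a v^T v, whence lambda_cs <= lambda_star.  The
   two bounds force equality at every atom of positive weight. *)
Require Import Defs.
From mathcomp Require Import all_boot all_order all_algebra.
From mathcomp Require Import boolp classical_sets reals ereal.
From mathcomp Require Import complex spectral mxtens zify ring lra.
From mathcomp Require Import -(notations) mpoly.

Set Implicit Arguments.
Unset Strict Implicit.

Import Order.TTheory GRing.Theory Num.Theory.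
Local Open Scope ring_scope.

(** * Trace bound for symmetric matrices through complex diagonalisation *)

Lemma ReM_real (R : rcfType) (a b : R[i]) :
  a \is Num.real -> complex.Re (a * b) = complex.Re a * complex.Re b.
Proof. by move=> /complex_realP[k ->]; case: b => u v; rewrite /= mul0r subr0. Qed.

Lemma Re_sum (R : rcfType) (I : finType) (f : I -> R[i]) :
  complex.Re (\sum_i f i) = \sum_i complex.Re (f i).
Proof. exact: (raddf_sum (@complex.Re R : Rcomplex R -> R)). Qed.

(** For real [W] the cross terms between the real and imaginary parts of [z] are purely imaginary. A
    real PSD matrix is thus nonnegative on complex vectors too, such as the rows of a unitary
    matrix. *)
Lemma Re_hermitian_form (R : rcfType) (n : nat) (W : 'M[R]_n) (z : 'rV[R[i]]_n) :
  complex.Re ((z *m map_mx (real_complex R) W *m map_mx Num.conj (z^T)) 0 0) =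
  (map_mx (@complex.Re R) z *m W *m (map_mx (@complex.Re R) z)^T) 0 0 +
  (map_mx (@complex.Im R) z *m W *m (map_mx (@complex.Im R) z)^T) 0 0.
Proof.
rewrite !mxE Re_sum -big_split /=; apply: eq_bigr => j _.
rewrite !mxE !mulr_suml Re_sum -big_split /=; apply: eq_bigr => k _.
rewrite !mxE /=; case: (z 0 j) => a b; case: (z 0 k) => c d /=; ring.
Qed.

(* The bound is read off the spectral decomposition of A over R[i]: for
   A = P^* diag(d) P, tr(A W) is the sum of the d_i weighted by the nonnegative
   diagonal entries of P W P^*. *)
Lemma sym_trace_ge (R : realType) (n : nat) (A : 'M[R]_n) :
  (0 < n)%N -> A^T = A ->
  exists2 mu : R, eigenvalue A mu &
    forall W : 'M[R]_n, psd W -> mu * \tr W <= \tr (A *m W).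
Proof.
case: n A => // n A _ A_sym.
pose Ac := map_mx (real_complex R) A.
have Ac_herm : Ac \is hermsymmx.
  apply/is_hermitianmxP/matrixP => i j.
  by rewrite expr0 scale1r !mxE conj_Creal ?complex_real // -[in RHS]A_sym mxE.
have /hermitian_normalmx/orthomx_spectralP := Ac_herm.
have /mxOverP := hermitian_spectral_diag_real Ac_herm.
have := spectral_unitarymx Ac.
move: (spectralmx Ac) (spectral_diag Ac) => P d P_unit d_real Ac_spec.
have P_inv := unitarymx_unit P_unit.
pose e i := complex.Re (d 0 i).
pose i0 := [arg min_(i < ord0) e i]%O.
have e_min i : e i0 <= e i.
  by rewrite /i0; case: arg_minP => // k _; exact.
have dE i : d 0 i = real_complex R (e i) by rewrite RRe_real.
(* The witness is the least diagonal entry of the spectral decomposition; row [i0] of [P] is an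
   eigenvector for it. *)
exists (e i0).
  rewrite eigenvalue_root_char -(fmorph_root (real_complex R)) map_char_poly.
  rewrite -/(map_mx _ A) -eigenvalue_root_char; apply/eigenvalueP.
  exists (row i0 P).
    rewrite -[X in X *: _]/(real_complex R (e i0)) -dE.
    rewrite [map_mx _ _]Ac_spec !mulmxA -row_mul mulmxV //.
    by rewrite row1 -rowE row_diag_mx -scalemxAl -rowE.
  apply/eqP => row0; have := P_inv.
  have /row_freeP[B PB] : row_free P by rewrite row_free_unit.
  move/(congr1 (mulmx^~ B)): row0; rewrite mul0mx -row_mul PB row1.
  by move/rowP/(_ i0); rewrite !mxE !eqxx => /eqP; rewrite oner_eq0.
move=> W [W_sym W_ge0].
pose w i := complex.Re ((P *m map_mx (real_complex R) W *m invmx P) i i).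
have w_ge0 i : 0 <= w i.
  rewrite /w invmx_unitary //.
  have -> : (P *m map_mx (real_complex R) W *m map_mx Num.conj P^T) i i =
    (row i P *m map_mx (real_complex R) W *m map_mx Num.conj (row i P)^T) 0 0.
    rewrite tr_row map_col -row_mul !mxE; apply: eq_bigr => j _.
    by rewrite !mxE.
  by rewrite Re_hermitian_form addr_ge0.
have trE (B : 'M[R]_n.+1) : \tr B = complex.Re (\tr (map_mx (real_complex R) B)).
  by rewrite trace_map_mx.
have -> : \tr W = \sum_i w i.
  rewrite trE -Re_sum -/(mxtrace _) mxtrace_mulC mulmxA mulVmx //.
  by rewrite mul1mx.
have -> : \tr (A *m W) = \sum_i e i * w i.
  rewrite trE map_mxM [map_mx _ A]Ac_spec -!mulmxA mxtrace_mulC -!mulmxA.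
  rewrite /mxtrace Re_sum; apply: eq_bigr => i _.
  by rewrite mul_diag_mx mxE ReM_real // mulmxA.
by rewrite mulr_sumr; apply: ler_sum => i _; apply: ler_wpM2r.
Qed.

(** * Positive semidefinite matrices and the smallest eigenvalue *)

Lemma psd_congr (R : realType) (k n : nat) (B : 'M[R]_(k, n)) (A : 'M[R]_n) :
  psd A -> psd (B *m A *m B^T).
Proof.
move=> [A_sym A_ge0]; split; first by rewrite !trmx_mul trmxK A_sym mulmxA.
move=> v; have := A_ge0 (v *m B).
by rewrite trmx_mul !mulmxA.
Qed.

Lemma psd_outer (R : realType) (n : nat) (v : 'rV[R]_n) : psd (v^T *m v).
Proof.
have -> : v^T *m v = v^T *m 1%:M *m v^T^T by rewrite trmxK mulmx1.
apply: psd_congr; split => [|w]; first by rewrite trmx1.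
by rewrite mulmx1 !mxE big_ord1 mxE -expr2 sqr_ge0.
Qed.

Lemma psd_cast (R : realType) (k n : nat) (e : k = n) (A : 'M[R]_k) :
  psd A -> psd (castmx (e, e) A).
Proof. by case: n / e. Qed.

(** A congruence by [tensmx v^T 1%:M] reduces the product to [tensmx 1%:M A] with a 1 x 1 identity,
    which is [A] up to a cast. *)
Lemma psd_tens_outer (R : realType) (p q : nat) (v : 'rV[R]_p) (A : 'M[R]_q) :
  psd A -> psd (tensmx (v^T *m v) A).
Proof.
move=> A_psd.
have -> : tensmx (v^T *m v) A =
    tensmx v^T 1%:M *m tensmx 1%:M A *m (tensmx v^T 1%:M)^T.
  by rewrite trmx_tens trmxK trmx1 !tensmx_mul mulmx1 mul1mx mulmx1.
by apply: psd_congr; rewrite tens_scalar1mx; apply: psd_cast.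
Qed.

(** The block matrix is a congruence of [A] by the column of blocks [(c i)%:M]. Moment and
    localizing matrices of a point mass both have this shape. *)
Lemma psd_mxblock_scale (R : realType) (k N : nat) (c : 'I_k -> R)
    (A : 'M[R]_N) :
  psd A -> psd (\mxblock_(i < k, j < k) ((c i * c j) *: A)).
Proof.
move=> A_psd.
have -> : \mxblock_(i < k, j < k) ((c i * c j) *: A) =
    (\mxcol_(i < k) (c i)%:M) *m A *m (\mxcol_(i < k) (c i)%:M)^T.
  rewrite tr_mxcol mxcol_mul mul_mxcol_mxrow; apply: eq_mxblock => i j.
  by rewrite tr_scalar_mx mul_scalar_mx mul_mx_scalar scalerA mulrC.
exact: psd_congr.
Qed.

(** Zero trace kills the nonnegative diagonal; testing the form on the sum and the difference of two
    unit vectors then kills each off-diagonal entry. *)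
Lemma psd_trace_gt0 (R : realType) (n : nat) (W : 'M[R]_n) :
  psd W -> W != 0 -> 0 < \tr W.
Proof.
move=> [W_sym W_ge0] W_neq0.
have formE a b i j : ((a *: delta_mx 0 i + b *: delta_mx 0 j : 'rV_n) *m W *m
    (a *: delta_mx 0 i + b *: delta_mx 0 j : 'rV_n)^T) 0 0 =
    a * a * W i i + a * b * W i j + (b * a * W j i + b * b * W j j) :> R.
  rewrite linearD !linearZ /= !trmx_delta mulmxDl mulmxDr !mulmxDl.
  rewrite -!scalemxAl -!scalemxAr -!rowE -!colE !mxE.
  ring.
have diag_ge0 i : 0 <= W i i.
  have := W_ge0 (1 *: delta_mx 0 i + 0 *: delta_mx 0 i).
  by rewrite formE !mul0r !mul1r mul0r !addr0.
rewrite lt_def sumr_ge0 // andbT; apply: contra W_neq0 => /eqP tr0.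
have diag0 i : W i i = 0 by exact: (psumr_eq0P (fun k _ => diag_ge0 k) tr0).
apply/eqP/matrixP => i j; rewrite mxE.
have W_ij : W j i = W i j by rewrite -[in LHS]W_sym mxE.
have := W_ge0 (1 *: delta_mx 0 i + 1 *: delta_mx 0 j).
have := W_ge0 (1 *: delta_mx 0 i + (-1) *: delta_mx 0 j).
rewrite !formE !diag0 W_ij; lra.
Qed.

Lemma trace_outer (R : realType) (n : nat) (A : 'M[R]_n) (v : 'rV[R]_n) :
  \tr (A *m (v^T *m v)) = (v *m A *m v^T) 0 0.
Proof. by rewrite mulmxA mxtrace_mulC mulmxA trace_mx11. Qed.

(** The trace bound applied to [v^T *m v], for any eigenvector [v], puts [mu] below every
    eigenvalue, so the infimum is attained at [mu]. *)
Lemma lambda_minP (R : realType) (n : nat) (A : 'M[R]_n) :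
  (0 < n)%N -> A^T = A ->
  (exists2 v : 'rV[R]_n, v *m A = lambda_min A *: v & v *m v^T = 1%:M) /\
  (forall W : 'M[R]_n, psd W -> lambda_min A * \tr W <= \tr (A *m W)).
Proof.
move=> n_gt0 A_sym; have [mu mu_eig mu_le] := sym_trace_ge n_gt0 A_sym.
have sq_gt0 (v : 'rV[R]_n) : v != 0 -> 0 < (v *m v^T) 0 0.
  move=> v_neq0; rewrite -trace_mx11 mxtrace_mulC.
  apply: psd_trace_gt0; first exact: psd_outer.
  apply: contra v_neq0 => /eqP vv0; apply/eqP/rowP => j.
  have /matrixP/(_ j j) := vv0; rewrite !mxE big_ord1 mxE => /eqP.
  by rewrite mulf_eq0 orbb => /eqP.
have mu_lb : lbound [set a : R | eigenvalue A a]%classic mu.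
  move=> a /= /eigenvalueP[v vA /sq_gt0 v_gt0].
  have := mu_le _ (psd_outer v).
  by rewrite trace_outer vA -scalemxAl mxE mxtrace_mulC trace_mx11 ler_pM2r.
have -> : lambda_min A = mu.
  apply/le_anti/andP; split; last by apply: lb_le_inf => //; exists mu.
  by apply: ge_inf => //; exists mu.
split=> //; have /eigenvalueP[v vA v_neq0] := mu_eig.
move: (sq_gt0 v v_neq0) (mx11_scalar (v *m v^T)).
move: ((v *m v^T) 0 0) => c c_gt0 vvE.
exists ((Num.sqrt c)^-1 *: v); first by rewrite -scalemxAl vA !scalerA mulrC.
rewrite linearZ /= -scalemxAl -scalemxAr scalerA vvE scale_scalar_mx.
by rewrite -invfM -expr2 sqr_sqrtr ?ltW // mulVf // gt_eqF.
Qed.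

(** * Evaluation of polynomial matrices and the Riesz functional *)

Lemma evalmxE (R : realType) (n p d : nat) (x : 'I_n -> R)
    (F : 'M[mpoly n R]_p) :
  (mxdeg F <= d)%N ->
  evalmx x F = \sum_(a : bmultinom n d.+1) mmap1 x a *: coefmx a F.
Proof.
move=> degF; apply/matrixP => i j; rewrite summxE mxE /meval (@mmapE _ _ _ _ _ _ d.+1).
  by apply: eq_bigr => a _; rewrite !mxE mulrC.
suff /leq_trans/(_ degF) : ((mmeasure mdeg (F i j)).-1 <= mxdeg F)%N.
  by case: mmeasure.
exact: leq_trans (leq_bigmax j) (leq_bigmax i).
Qed.

Lemma eq_mmap1 (R : realType) (n : nat) (x y : 'I_n -> R) (a : multinom n) :
  (forall i, i \in msupport a -> x i = y i) -> mmap1 x a = mmap1 y a.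
Proof.
move=> eq_xy; apply: eq_bigr => i _; have := eq_xy i; rewrite inE.
by case: eqP => [-> _|_ -> //]; rewrite !expr0.
Qed.

Lemma eq_evalmx (R : realType) (n p : nat) (x y : 'I_n -> R)
    (F : 'M[mpoly n R]_p) :
  (forall i, occurs F i -> x i = y i) -> evalmx x F = evalmx y F.
Proof.
move=> eq_xy; rewrite !(evalmxE _ (leqnn _)); apply: eq_bigr => a _.
have [->|Fa_neq0] := eqVneq (coefmx a F) 0; first by rewrite !scaler0.
by congr (_ *: _); apply: eq_mmap1 => i ai; apply: eq_xy; exists (a : multinom n).
Qed.

Lemma evalmx_sym (R : realType) (n p : nat) (x : 'I_n -> R)
    (F : 'M[mpoly n R]_p) :
  F^T = F -> (evalmx x F)^T = evalmx x F.
Proof. by move=> F_sym; rewrite /evalmx map_trmx F_sym. Qed.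

Lemma mom_restrict (R : realType) (n p d : nat) (f : multinom n -> 'M[R]_p)
    (a : multinom n) :
  (mdeg a <= d)%N -> mom (fun b : bmultinom n d.+1 => f b) a = f a.
Proof. by move=> a_le; rewrite /mom insubT. Qed.

(** The atomic formula is asked only where [F] has a nonzero coefficient: the clique measures give
    no information on [S a] when the support of [a] lies in no clique. *)
Lemma riesz_atomic (R : realType) (n p d s : nat) (S : momseq R n p d)
    (F : 'M[mpoly n R]_p) (W : 'I_s -> 'M[R]_p) (x : 'I_s -> 'I_n -> R) :
  (mxdeg F <= d)%N ->
  (forall a : bmultinom n d.+1, coefmx a F != 0 ->
     S a = \sum_(i < s) mmap1 (x i) a *: W i) ->
  riesz S F = \sum_(i < s) \tr (evalmx (x i) F *m W i).
Proof.
move=> degF S_atomic.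
under [RHS]eq_bigr => i _ do rewrite (evalmxE _ degF) mulmx_suml raddf_sum.
rewrite exchange_big; apply: eq_bigr => a _ /=.
have [Fa0|Fa_neq0] := eqVneq (coefmx a F) 0.
  rewrite Fa0 mul0mx mxtrace0 big1 // => i _.
  by rewrite scaler0 mul0mx mxtrace0.
rewrite S_atomic // mulmx_sumr raddf_sum; apply: eq_bigr => i _ /=.
by rewrite -scalemxAl -scalemxAr.
Qed.

Lemma mxdeg1 (R : realType) (n p : nat) : mxdeg (1%:M : 'M[mpoly n R]_p) = 0%N.
Proof.
apply/eqP; rewrite -leqn0; apply/bigmax_leqP => i _; apply/bigmax_leqP => j _.
by rewrite mxE; case: eqP => _; rewrite ?mulr1n ?mulr0n ?mmeasure0 ?msize1.
Qed.

Lemma evalmx1 (R : realType) (n p : nat) (x : 'I_n -> R) :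
  evalmx x (1%:M : 'M[mpoly n R]_p) = 1%:M.
Proof. by rewrite /evalmx map_mx1. Qed.

Lemma leq_mxdeg_half (R : realType) (n p : nat) (F : 'M[mpoly n R]_p) (r : nat) :
  (half_deg F <= r)%N -> (mxdeg F <= 2 * r)%N.
Proof. by rewrite leq_uphalf_double mul2n. Qed.

(** * Moments of a rank-one matrix weight at a single point *)

Section DiracMoments.
Variables (R : realType) (n p r : nat) (x : 'I_n -> R) (v : 'rV[R]_p).

Let S : momseq R n p (2 * r) :=
  fun a : bmultinom n (2 * r).+1 => mmap1 x a *: (v^T *m v).

Lemma mom_dirac (a : multinom n) :
  (mdeg a <= 2 * r)%N -> mom S a = mmap1 x a *: (v^T *m v).
Proof. exact: (mom_restrict (fun a => mmap1 x a *: (v^T *m v))). Qed.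

Lemma mmap1D (a b : multinom n) :
  mmap1 x (mnm_add a b) = mmap1 x a * mmap1 x b.
Proof. exact: commr_mmap1_M (fun _ _ => mulrC _ _). Qed.

Lemma riesz_dirac (F : 'M[mpoly n R]_p) :
  (mxdeg F <= 2 * r)%N -> riesz S F = (v *m evalmx x F *m v^T) 0 0.
Proof.
move=> degF.
rewrite (@riesz_atomic _ _ _ _ 1 S F (fun=> v^T *m v) (fun=> x)) //.
  by rewrite big_ord1 trace_outer.
by move=> a _; rewrite big_ord1.
Qed.

Lemma psd_moment_dirac (C : {set 'I_n}) : psd (moment_mx S r C).
Proof.
rewrite /moment_mx.
have -> : \mxblock_(i < #|mbasis C r|, j < #|mbasis C r|)
    mom S (mnm_add (enum_val i) (enum_val j)) =
  \mxblock_(i < #|mbasis C r|, j < #|mbasis C r|)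
    ((mmap1 x (enum_val i) * mmap1 x (enum_val j)) *: (v^T *m v)).
  apply: eq_mxblock => i j; rewrite mom_dirac ?mmap1D //.
  by rewrite mdegD mul2n -addnn leq_add // -ltnS bmdeg.
pose c (i : 'I_#|mbasis C r|) := mmap1 x (enum_val i : bmultinom n r.+1).
exact: (psd_mxblock_scale c (psd_outer v)).
Qed.

Lemma psd_localizing_dirac (q : nat) (G : 'M[mpoly n R]_q) (C : {set 'I_n}) :
  (half_deg G <= r)%N -> psd (evalmx x G) ->
  psd (localizing_mx S G (r - half_deg G) C).
Proof.
move=> degG G_psd; rewrite /localizing_mx; set e := (r - half_deg G)%N.
have -> : \mxblock_(i < #|mbasis C e|, j < #|mbasis C e|)
     \sum_(c : bmultinom n (mxdeg G).+1)
        tensmx (mom S (mnm_add (mnm_add (enum_val i) (enum_val j)) c))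
               (coefmx c G) =
  \mxblock_(i < #|mbasis C e|, j < #|mbasis C e|)
    ((mmap1 x (enum_val i) * mmap1 x (enum_val j)) *:
     tensmx (v^T *m v) (evalmx x G)).
  apply: eq_mxblock => i j; rewrite (evalmxE x (leqnn _)).
  apply/matrixP => k l; rewrite summxE !mxE summxE !mulr_sumr.
  apply: eq_bigr => c _; rewrite mom_dirac ?mmap1D.
    by rewrite !mxE; ring.
  (* The two basis indices have degree at most [r - half_deg G] and [c] at most [2 * half_deg G], so
     the sum stays within [2 * r], where [mom] is not junk. *)
  have := leq_mxdeg_half (leqnn (half_deg G)).
  have := bmdeg (enum_val i); have := bmdeg (enum_val j); have := bmdeg c.
  by rewrite !mdegD /e; lia.
pose c (i : 'I_#|mbasis C e|) := mmap1 x (enum_val i : bmultinom n e.+1).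
exact: (psd_mxblock_scale c (psd_tens_outer v G_psd)).
Qed.

Lemma cs_feasible_dirac (m t : nat) (q : 'I_m -> nat)
    (G : forall k : 'I_m, 'M[mpoly n R]_(q k)) (I : 'I_t -> {set 'I_n})
    (J : 'I_t -> {set 'I_m}) :
  (forall k, (half_deg (G k) <= r)%N) -> feasible G x -> v *m v^T = 1%:M ->
  cs_feasible G I J S.
Proof.
move=> degG x_feas v_unit; split=> [a|l|l k _|].
- by rewrite linearZ /= trmx_mul trmxK.
- exact: psd_moment_dirac.
- exact: psd_localizing_dirac.
- by rewrite riesz_dirac ?mxdeg1 // evalmx1 mulmx1 v_unit mxE.
Qed.

End DiracMoments.

(** * Comparison of the two optimal values *)

Lemma lambda_cs_le_star (R : realType) (n p m t r : nat) (q : 'I_m -> nat)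
    (F : 'M[mpoly n R]_p) (G : forall k : 'I_m, 'M[mpoly n R]_(q k))
    (I : 'I_t -> {set 'I_n}) (J : 'I_t -> {set 'I_m}) :
  (0 < p)%N -> F^T = F -> (r_min F G <= r)%N ->
  (lambda_cs F G I J r <= lambda_star F G)%E.
Proof.
move=> p_gt0 F_sym; rewrite geq_max => /andP[degF /bigmax_leqP degG].
apply: le_ereal_inf_tmp => _ [x x_feas <-].
have [[v vF v_unit] _] := lambda_minP p_gt0 (evalmx_sym x F_sym).
apply: ereal_inf_lbound.
exists (fun a : bmultinom n (2 * r).+1 => mmap1 x a *: (v^T *m v)).
  by apply: cs_feasible_dirac => // k; exact: degG.
rewrite riesz_dirac ?leq_mxdeg_half //.
by rewrite vF -scalemxAl v_unit !mxE mulr1.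
Qed.

Lemma extend0E (R : realType) (n : nat) (C : {set 'I_n}) (y : subpoint R C)
    (z : 'I_n -> R) (j : 'I_n) :
  (forall u : {j : 'I_n | j \in C}, z (val u) = y u) -> j \in C ->
  extend0 y j = z j.
Proof. by move=> zE jC; rewrite /extend0 insubT -zE. Qed.

(** As every clique extends to a maximal one, this places the support of each monomial of [F] inside
    some [I l]. *)
Lemma clique_msupport (R : realType) (n p m : nat) (q : 'I_m -> nat)
    (F : 'M[mpoly n R]_p) (G : forall k : 'I_m, 'M[mpoly n R]_(q k))
    (a : multinom n) :
  coefmx a F != 0 -> clique (csp_graph F G) (msupport a).
Proof.
move=> Fa_neq0; apply/forall_inP => i ai; apply/forall_inP => j aj.
apply/implyP => i_neq_j; rewrite /csp_graph i_neq_j.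
by apply/asboolP; left; exists a.
Qed.

(* A matrix W i = 0 contributes no atom to the measures, and then xhat i is an
   arbitrary feasible point: optimality is asserted of the actual atoms. *)
Theorem theorem5p4 (R : realType) (n p m : nat) (q : 'I_m -> nat)
    (F : 'M[mpoly n R]_p) (G : forall k : 'I_m, 'M[mpoly n R]_(q k))
    (p_gt0 : (0 < p)%N)
    (F_sym : F^T = F) (G_sym : forall k : 'I_m, (G k)^T = G k)
    (t : nat) (I : 'I_t -> {set 'I_n}) (J : 'I_t -> {set 'I_m})
    (I_cliques : enumerates_maximal_cliques (csp_graph F G) I)
    (J_assign : csp_assignment G I J)
    (r : nat) (r_ge : (r_min F G <= r)%N)
    (S : momseq R n p (2 * r)) (S_opt : cs_optimal F G I J S)
    (s : nat) (W : 'I_s -> 'M[R]_p) (W_psd : forall i : 'I_s, psd (W i))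
    (x : forall l : 'I_t, 'I_s -> subpoint R (I l))
    (x_in_K : forall (l : 'I_t) (i : 'I_s), Kset G (J l) (x l i))
    (x_repr : forall l : 'I_t, represents S W (x l))
    (xhat : 'I_s -> 'I_n -> R)
    (x_merge : forall (i : 'I_s) (l : 'I_t) (u : {j : 'I_n | j \in I l}),
       xhat i (val u) = x l i u) :
  lambda_cs F G I J r = lambda_star F G /\
  (forall i : 'I_s, W i != 0 -> pmo_optimal F G (xhat i)).
Proof.
have [_ I_max] := I_cliques; have [_ J_cover J_vars] := J_assign.
have [S_feas riesz_opt] := S_opt; have [_ _ _ riesz1] := S_feas.
have xhatE l i j : j \in I l -> extend0 (x l i) j = xhat i j.
  by apply: extend0E => u; exact: x_merge.
(* The variables of [G k] lie in [I l] for the [l] with [k \in J l], so the zero extension of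
   [x l i] and [xhat i] give [G k] the same value. *)
have xhat_feas i : feasible G (xhat i).
  move=> k; have : k \in (\bigcup_(l < t) J l)%SET by rewrite J_cover inE.
  move=> /bigcupP[l _ kJ].
  rewrite -(@eq_evalmx _ _ _ (extend0 (x l i))); first exact: x_in_K.
  by move=> j /(J_vars l k kJ); exact: xhatE.
(* Because the weights are shared by all cliques and the points merge, the formula no longer depends
   on the maximal clique chosen around [a]. *)
have S_atomic (a : bmultinom n (2 * r).+1) :
    clique (csp_graph F G) (msupport a) ->
    S a = \sum_(i < s) mmap1 (xhat i) a *: W i.
  move=> /maxset_exists[_ /I_max[l <-] aI].
  rewrite (x_repr l _ aI); apply: eq_bigr => i _.
  congr (_ *: _); apply: eq_mmap1 => j aj; apply: xhatE.
  exact: (fintype.subsetP aI).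
have rieszF : riesz S F = \sum_(i < s) \tr (evalmx (xhat i) F *m W i).
  apply: riesz_atomic => [|a Fa_neq0].
    by apply: leq_mxdeg_half; apply: leq_trans r_ge; exact: leq_maxl.
  exact: S_atomic (clique_msupport G Fa_neq0).
have trW : \sum_(i < s) \tr (W i) = 1.
  rewrite -riesz1 (@riesz_atomic _ _ _ _ _ _ _ W xhat) ?mxdeg1 //.
    by apply: eq_bigr => i _; rewrite evalmx1 mul1mx.
  (* The identity has a nonzero coefficient only at the zero multi-index, whose empty support is
     trivially a clique. *)
  move=> a a_neq0; apply: S_atomic; apply/forall_inP => i.
  rewrite inE => ai; case/eqP: a_neq0; apply/matrixP => j k; rewrite !mxE.
  case: (j == k); rewrite ?mulr1n ?mulr0n ?mcoeff0 // mcoeff1.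
  by case: eqP => // a0; rewrite a0 mnm0E in ai.
have trW_ge0 i : 0 <= \tr (W i).
  have [->|/(psd_trace_gt0 (W_psd i))/ltW //] := eqVneq (W i) 0.
  by rewrite mxtrace0.
set opt := riesz S F in riesz_opt rieszF.
pose mu i := lambda_min (evalmx (xhat i) F).
have opt_star : (opt%:E <= lambda_star F G)%E.
  by rewrite riesz_opt; exact: lambda_cs_le_star.
have star_mu i : (lambda_star F G <= (mu i)%:E)%E.
  by apply: ereal_inf_lbound; exists (xhat i).
have opt_mu i : opt <= mu i by rewrite -lee_fin (le_trans opt_star).
have mu_tr i : mu i * \tr (W i) <= \tr (evalmx (xhat i) F *m W i).
  by have [_] := lambda_minP p_gt0 (evalmx_sym (xhat i) F_sym); apply.
have gap_ge0 i : true -> 0 <= (mu i - opt) * \tr (W i).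
  by move=> _; rewrite mulr_ge0 // subr_ge0.
(* Since the traces sum to 1, [mu_tr] bounds this sum by [riesz S F - opt], which is 0; its terms
   are nonnegative, so each one vanishes. *)
have gap0 : \sum_(i < s) (mu i - opt) * \tr (W i) = 0.
  apply/le_anti; rewrite sumr_ge0 // andbT.
  under eq_bigr => i _ do rewrite mulrBl.
  by rewrite sumrB -mulr_sumr trW mulr1 subr_le0 rieszF ler_sum.
have mu_opt i : W i != 0 -> mu i = opt.
  move=> /(psd_trace_gt0 (W_psd i))/gt_eqF trW_neq0.
  have /eqP := psumr_eq0P gap_ge0 gap0 (i := i) isT.
  by rewrite mulf_eq0 trW_neq0 orbF subr_eq0 => /eqP.
(* Traces summing to 1 leave some weight nonzero; at that atom [opt] equals [mu i0], which is at
   least [lambda_star]. *)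
have [i0 W_neq0] : exists i, W i != 0.
  apply/existsP; apply: contraT => /existsPn W0; case/eqP: (oner_neq0 R).
  by rewrite -trW big1 // => i _; have /negPn/eqP -> := W0 i; exact: mxtrace0.
have star_opt : opt%:E = lambda_star F G.
  by apply/le_anti; rewrite opt_star -(mu_opt i0 W_neq0) star_mu.
split; first by rewrite -riesz_opt.
move=> i /mu_opt mu_i; split; first exact: xhat_feas.
by rewrite -star_opt -mu_i.
Qed.
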